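(* Let $H\in(0,1)\setminus\{1/2\}$, $p=1/H$, $\kappa_H:=\min\{1,2-2H\}$, and let $\pi=(\pi_n)_{n\ge1}$ be a fixed deterministic sequence of finite partitions of $[0,1]$ with $\operatorname{mesh}(\pi_n)=o\bigl((\log n)^{-1/\kappa_H}\bigr)$ as $n\to\infty$. Let $X^H$ be the random signed Takagi--Landsberg bridge of index $H$. Then the following are equivalent: (i) $[X^H]^{(p)}_{(\pi_n)}$ converges almost surely; (ii) $[X^H]^{(p)}_{(\pi_n)}$ converges in probability; (iii) the deterministic sequence $\mathbb E\,[X^H]^{(p)}_{(\pi_n)}$ converges. When they hold, the almost-sure limit is $\lim_n\mathbb E\,[X^H]^{(p)}_{(\pi_n)}$.
   Context: Faber--Schauder functions: for $n\ge0$ and $0\le k<2^n$, $e_{n,k}(t)=2^{-n/2}e_{0,0}(2^nt-k)$, where $e_{0,0}(u)=\max\{0,\min(u,1-u)\}$. Let $\{\theta_{n,k}\}$ be independent Rademacher random variables ($\pm1$ with probability $1/2$ each). For $H\in(0,1)$ the random signed Takagi--Landsberg bridge of index $H$ is $$X^H_t=\sum_{n=0}^\infty2^{n(1/2-H)}\sum_{k=0}^{2^n-1}\theta_{n,k}e_{n,k}(t),\qquad0\le t\le1,$$ where the series converges uniformly for every choice of signs. For a finite partition $\tau=\{0=t_0<\cdots<t_N=1\}$, $\operatorname{mesh}(\tau)=\max_i(t_{i+1}-t_i)$; for continuous $x$ and $p\ge1$, $[x]^{(p)}_{(\tau)}=\sum_{i=0}^{N-1}|x(t_{i+1})-x(t_i)|^p$.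 Deterministic means that the partition points do not depend on the signs. *)

(* Defs.v *)
From HB Require Import structures.
From mathcomp Require Import all_boot all_order all_algebra finmap.
From mathcomp Require Import all_classical all_reals all_analysis.

Set Implicit Arguments.
Unset Strict Implicit.
Unset Printing Implicit Defensive.

Import Order.TTheory GRing.Theory Num.Theory.
Import numFieldNormedType.Exports.

Local Open Scope classical_set_scope.
Local Open Scope ring_scope.

(* A partition {0 = t_0 < ... < t_N = 1} is encoded, as in [itv_partition 0 1 s],
   by the list s = [:: t_1; ...; t_N]; the points are those of 0 :: s. *)
Definition mesh (R : realType) (s : seq R) : R :=
  \big[Num.max/0]_(0 <= i < size s) ((0 :: s)`_i.+1 - (0 :: s)`_i).

Definition pvariation (R : realType) (p : R) (s : seq R) (x : R -> R) : R :=
  \sum_(0 <= i < size s) `|x (0 :: s)`_i.+1 - x (0 :: s)`_i| `^ p.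

Definition schauder00 (R : realType) (u : R) : R :=
  Num.max 0 (Num.min u (1 - u)).

Definition schauder (R : realType) (n k : nat) (t : R) : R :=
  2 `^ (- (n%:R / 2)) * schauder00 (2 ^+ n * t - k%:R).

Section probability.
Context (d : measure_display) (T : measurableType d) (R : realType).
Variable P : probability T R.

Definition rademacher (X : {RV P >-> R}) : Prop :=
  P (X @^-1` [set 1]) = (2^-1)%:E /\ P (X @^-1` [set -1]) = (2^-1)%:E.

Definition mutually_independent (I : choiceType) (X : I -> {RV P >-> R}) : Prop :=
  forall (J : {fset I}) (B : I -> set R), (forall i, measurable (B i)) ->
    P (\bigcap_(i in [set` J]) (X i @^-1` B i)) =
    (\prod_(i <- J) P (X i @^-1` B i))%E.

Definition independent_rademacher
    (theta : forall n : nat, 'I_(2 ^ n) -> {RV P >-> R}) : Prop :=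
  (forall n k, rademacher (theta n k)) /\
  mutually_independent
    (fun i : {n : nat & 'I_(2 ^ n)} => theta (tag i) (tagged i)).

(* Where some theta n k w is not a sign (a null event), the series need not
   converge and the value of [limn] is then irrelevant. *)
Definition takagi_landsberg (H : R)
    (theta : forall n : nat, 'I_(2 ^ n) -> {RV P >-> R}) (t : R) (w : T) : R :=
  limn (series (fun n : nat =>
    2 `^ (n%:R * (2^-1 - H)) *
      \sum_(k < 2 ^ n) theta n k w * schauder n k t)).

Definition converges_as (V : nat -> T -> R) : Prop :=
  {ae P, forall w, cvgn (fun n => V n w)}.

Definition converges_in_probability (V : nat -> T -> R) : Prop :=
  exists Y : {RV P >-> R}, forall e : R, 0 < e ->
    P [set w | e <= `|V n w - Y w|] @[n --> \oo] --> 0%E.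

End probability.

(* Main.v *)
Require Import Defs.
From HB Require Import structures.
From mathcomp Require Import all_boot all_order all_algebra finmap.
From mathcomp Require Import all_classical all_reals all_analysis.
From mathcomp Require Import measurable_realfun ring lra.

Set Implicit Arguments.
Unset Strict Implicit.
Unset Printing Implicit Defensive.

Import Order.TTheory GRing.Theory Num.Theory.
Import numFieldNormedType.Exports.

Local Open Scope classical_set_scope.
Local Open Scope ring_scope.

(** The [p]-th variation along a partition is a function of the signs of the
series, and it concentrates around its mean so strongly that almost sure
convergence, convergence in probability and convergence of the means are all the
same thing.

All paths are [H]-Hoelder with a constant that does not depend on the signs
([signed_takagi_holder]). With [p = 1 / H], flipping one sign therefore changes
the variation by at most a sum of [D `^ (1 - H)] times the change of the
increment over each interval, of length [D], of the partition
([grid_variation_update]). The squares of these sensitivities add up to at most a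
constant times [mesh `^ kappa] ([sum_sqr_sensitivity]); the value of [kappa]
depends on whether fine or coarse levels of the series dominate.

McDiarmid's inequality for fair signs ([sign_average_exp], transported to the
probability space by [expectation_exp_le]) then gives sub-Gaussian exponential
moments, first for finitely many levels and in the limit for the whole series
([concentration]). Since [mesh `^ kappa = o (1 / ln n)], the probability of a
deviation by [t] is eventually at most [2 / n ^ 2], so by Borel-Cantelli the
difference between the variation and its mean tends to [0] almost surely
([ae_cvg_deviation0]). Each of the three modes of convergence then amounts to
convergence of the means; for convergence in probability this uses that a
deterministic sequence close in probability to a fixed random variable is a Cauchy
sequence ([converges_in_probability_mean]). *)

(** * Increments of tent functions *)

Section tent.
Context {R : realType}.
Implicit Types (u x y a : R) (n K : nat).

(** Total variation of the tent function on the half line left of the argument;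
it dominates the increments of the tent and telescopes both along a monotone
sequence of points and along integer translates. *)
Definition clamp01 u : R := Num.max 0 (Num.min u 1).

Lemma clamp01_ge0 u : 0 <= clamp01 u.
Proof. by rewrite /clamp01 le_max lexx. Qed.

Lemma clamp01_le1 u : clamp01 u <= 1.
Proof. by rewrite /clamp01 ge_max ler01 ge_min lexx orbT. Qed.

Lemma clampP u : [\/ u <= 0 /\ clamp01 u = 0, 0 <= u <= 1 /\ clamp01 u = u |
  1 <= u /\ clamp01 u = 1].
Proof.
rewrite /clamp01; have [u1|u1] := leP u 1.
  have [u0|u0] := leP 0 u; first by apply: Or32.
  by apply: Or31; split=> //; exact: ltW.
by apply: Or33; rewrite max_r ?ler01//; split=> //; exact: ltW.
Qed.

(** The tent and its variation function are affine on the same four pieces, so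
this joint case split keeps the later comparisons small. *)
Lemma tentP u : [\/ [/\ u <= 0, schauder00 u = 0 & clamp01 u = 0],
  [/\ 0 <= u <= 2^-1, schauder00 u = u & clamp01 u = u],
  [/\ 2^-1 <= u <= 1, schauder00 u = 1 - u & clamp01 u = u] |
  [/\ 1 <= u, schauder00 u = 0 & clamp01 u = 1]].
Proof.
rewrite /schauder00; case: (leP u (1 - u)) => u1.
  case: (leP 0 u) (clampP u) => u0 [[? ->]|[? ->]|[? ->]]; try (exfalso; lra).
  - by apply: Or42; split=> //; [apply/andP; split; lra|lra].
  - by apply: Or42; split=> //; apply/andP; split; lra.
  - by apply: Or41; split=> //; exact: ltW.
case: (leP 0 (1 - u)) (clampP u) => u0 [[? ->]|[? ->]|[? ->]]; try (exfalso; lra).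
- by apply: Or43; split=> //; apply/andP; split; lra.
- by apply: Or43; split=> //; [apply/andP; split; lra|lra].
- by apply: Or44; split=> //; lra.
Qed.

Lemma tent_clamp x y : y <= x ->
  `|schauder00 x - schauder00 y| <= clamp01 x - clamp01 y.
Proof.
move=> yx; rewrite ler_norml.
by case: (tentP x) (tentP y) => [[? -> ->]|[? -> ->]|[? -> ->]|[? -> ->]]
  [[? -> ->]|[? -> ->]|[? -> ->]|[? -> ->]]; apply/andP; split; lra.
Qed.

Lemma tent_ge0 u : 0 <= schauder00 u.
Proof. by rewrite /schauder00 le_max lexx. Qed.

Lemma tent_le_clamp u : schauder00 u <= clamp01 (u + 1) - clamp01 u.
Proof.
by case: (tentP u) (clampP (u + 1)) =>
  [[? -> ->]|[? -> ->]|[? -> ->]|[? -> ->]] [[? ->]|[? ->]|[? ->]]; lra.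
Qed.

(** The tent rises by 1/2 and falls by 1/2, so its total variation is 1. *)
Lemma sum_tent_increment (u : nat -> R) N :
  (forall i, (i < N)%N -> u i <= u i.+1) ->
  \sum_(0 <= i < N) `|schauder00 (u i.+1) - schauder00 (u i)| <= 1.
Proof.
move=> u_nd.
apply: (@le_trans _ _ (\sum_(0 <= i < N) (clamp01 (u i.+1) - clamp01 (u i)))).
  rewrite big_nat_cond [leRHS]big_nat_cond.
  by apply: ler_sum => i /andP[/andP[_ iN] _]; exact/tent_clamp/u_nd.
rewrite telescope_sumr//.
have := clamp01_ge0 (u 0%N); have := clamp01_le1 (u N); lra.
Qed.

Lemma sum_clamp_shift K x y : y <= x ->
  \sum_(k < K) (clamp01 (x - k%:R) - clamp01 (y - k%:R)) <= x - y.
Proof.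
move=> yx.
have S n z : [\/ z <= 0 /\ \sum_(k < n) clamp01 (z - k%:R) = 0,
    0 <= z <= n%:R /\ \sum_(k < n) clamp01 (z - k%:R) = z |
    n%:R <= z /\ \sum_(k < n) clamp01 (z - k%:R) = n%:R].
  elim: n => [|n IH].
    rewrite big_ord0; have [z0|z0] := leP z 0; first by apply: Or31.
    by apply: Or33; split=> //; exact: ltW.
  rewrite big_ord_recr/= -natr1; have := ler0n R n; set c := n%:R => c0.
  case: IH (clampP (z - c)) => [[? ->]|[? ->]|[? ->]] [[? ->]|[? ->]|[? ->]];
    rewrite -/c; try (exfalso; lra).
  - by apply: Or31; split; lra.
  - by apply: Or31; split; lra.
  - by apply: Or32; split; lra.
  - by apply: Or32; split; lra.
  - by apply: Or32; split; lra.
  - by apply: Or32; split; lra.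
  - by apply: Or33; split; lra.
rewrite sumrB; have := ler0n R K; set c := K%:R => c0.
by case: (S K x) (S K y) => [[? ->]|[? ->]|[? ->]] [[? ->]|[? ->]|[? ->]];
  rewrite -/c in c0 *; lra.
Qed.

Lemma sum_tent_shift K x : \sum_(k < K) schauder00 (x - k%:R) <= 1.
Proof.
apply: (@le_trans _ _ (\sum_(k < K) (clamp01 ((x + 1) - k%:R) - clamp01 (x - k%:R)))).
  apply: ler_sum => k _; apply: le_trans (tent_le_clamp _) _.
  by rewrite addrAC.
by apply: le_trans (sum_clamp_shift _ _) _; lra.
Qed.

(** An increment of a whole dyadic level is bounded in two ways: the translates
have essentially disjoint supports, which gives a constant bound, and their
variation functions add up to a 1-Lipschitz function. *)
Lemma sum_tent_shift_increment K x y : y <= x ->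
  \sum_(k < K) `|schauder00 (x - k%:R) - schauder00 (y - k%:R)|
    <= 2 * Num.min (x - y) 1.
Proof.
move=> yx.
have h1 : \sum_(k < K) `|schauder00 (x - k%:R) - schauder00 (y - k%:R)| <= x - y.
  apply: le_trans (sum_clamp_shift K yx).
  by apply: ler_sum => k _; apply: tent_clamp; rewrite lerD2r.
have h2 : \sum_(k < K) `|schauder00 (x - k%:R) - schauder00 (y - k%:R)| <= 1 + 1.
  apply: le_trans (lerD (sum_tent_shift K x) (sum_tent_shift K y)).
  rewrite -big_split/=; apply: ler_sum => k _.
  rewrite ler_norml; have := tent_ge0 (x - k%:R); have := tent_ge0 (y - k%:R).
  by move=> *; apply/andP; split; lra.
by rewrite /Num.min; case: ifPn; rewrite -?leNgt => *; lra.
Qed.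

End tent.

(** * Capped geometric sums *)

Section geometric.
Context {R : realType}.

Lemma powR2N_lt1 (a : R) : 0 < a -> 2 `^ (- a) < 1 :> R.
Proof.
move=> a0; rewrite powRN invf_lt1 ?powR_gt0//.
by rewrite -[ltLHS](powRr0 (2:R)) /powR pnatr_eq0/= ltr_expR ltr_pM2r// ln_gt0// ltr1n.
Qed.

Lemma double_powR2N (a : R) : 2 * 2 `^ (- a) = 2 `^ (- (a - 1)) :> R.
Proof.
rewrite -{1}(@powRr1 _ (2:R))// -powRD ?pnatr_eq0 ?implybT//.
by rewrite opprB.
Qed.

(** Up to a factor 2, a bound for the increment over a distance [x] of the first
[N] levels of a Takagi-Landsberg series with amplitudes [q ^+ m]: a level is
Lipschitz at small distances and bounded at large ones. *)
Definition capped_geometric (q : R) (N : nat) (x : R) : R :=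
  \sum_(m < N) q ^+ m * Num.min (2 ^+ m * x) 1.

Lemma capped_geometricS q N x : capped_geometric q N.+1 x =
  Num.min x 1 + q * capped_geometric q N (2 * x).
Proof.
rewrite /capped_geometric big_ord_recl !expr0 !mul1r mulr_sumr; congr (_ + _).
apply: eq_bigr => i _; rewrite lift0 exprS -mulrA.
by congr (_ * (_ * Num.min _ _)); rewrite exprSr mulrA.
Qed.

(** The sum is self-similar: [S_(N+1)(x) = min(x, 1) + q * S_N(2 x)], and [x `^ a]
is the homogeneous solution of this recursion. The induction needs the
stronger bound [A * x `^ a - B * x], where the linear term absorbs
[min(x, 1)]; beyond [x = 1/2] the crude bound by the full geometric series
takes over, and [A] is chosen to match there. *)
Lemma capped_geometric_le a q : 0 < a -> a < 1 -> q = 2 `^ (- a) ->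
  exists2 C : R, 0 < C & forall N x, 0 <= x -> x <= 1 ->
  capped_geometric q N x <= C * x `^ a.
Proof.
move=> a0 a1 qE.
have q0 : 0 < q by rewrite qE powR_gt0.
have q1 : q < 1 by rewrite qE powR2N_lt1.
have q2 : 1 < 2 * q.
  rewrite qE double_powR2N opprB -[1 - a]opprK powRN invf_gt1 ?powR_gt0//.
  by apply: powR2N_lt1; lra.
pose D := (1 - q)^-1; pose B := (2 * q - 1)^-1; pose A := q^-1 * (D + B).
have D0 : 0 < D by rewrite invr_gt0 subr_gt0.
have B0 : 0 < B by rewrite invr_gt0 subr_gt0.
have DE : D * (1 - q) = 1 by rewrite /D mulVf//; lra.
have BE : B * (2 * q - 1) = 1 by rewrite /B mulVf//; lra.
have A0 : 0 < A by rewrite mulr_gt0 ?invr_gt0// addr_gt0.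
have SD N x : capped_geometric q N x <= D.
  elim: N x => [|N IH] x; first by rewrite /capped_geometric big_ord0 ltW.
  rewrite capped_geometricS.
  have := IH (2 * x); rewrite -(ler_pM2l q0) => h.
  have : Num.min x 1 <= 1 by rewrite ge_min lexx orbT.
  nra.
exists A => // N x x0 x1.
suff : capped_geometric q N x <= A * x `^ a - B * x by nra.
elim: N x x0 x1 => [|N IH] x x0 x1.
  rewrite /capped_geometric big_ord0 subr_ge0.
  apply: (@le_trans _ _ (B * x `^ a)).
    rewrite ler_pM2l//; have [->|xn0] := eqVneq x 0; first exact: powR_ge0.
    by apply: ger1_powR; [rewrite lt_neqAle eq_sym xn0 x0|exact: ltW].
  rewrite ler_wpM2r ?powR_ge0//.
  rewrite /A -(ler_pM2l q0) mulrA divff ?gt_eqF// mul1r; nra.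
have [x2|x2] := leP (2 * x) 1.
  rewrite capped_geometricS min_l//.
  have := IH (2 * x) (mulr_ge0 (ler0n R 2) x0) x2; rewrite -(ler_pM2l q0).
  have -> : (2 * x) `^ a = q^-1 * x `^ a.
    by rewrite powRM// qE -powRN opprK.
  set X := x `^ a.
  have -> : q * (A * (q^-1 * X) - B * (2 * x)) = A * X - 2 * q * B * x.
    by field; rewrite gt_eqF.
  move=> h.
  have : B * (2 * q - 1) * x = x by rewrite BE mul1r.
  nra.
apply: le_trans (SD _ _) _.
have xa : q <= x `^ a.
  rewrite qE powRN -[leLHS]powR_inv1 ?powR_ge0// -powRrM mulrN1.
  have -> : (2:R) `^ (- a) = (2^-1) `^ a.
    by rewrite -powR_inv1// -powRrM mulN1r.
  by apply: ge0_ler_powR; rewrite ?nnegrE ?ltW//; lra.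
have : A * q <= A * x `^ a by rewrite ler_pM2l.
have -> : A * q = D + B by rewrite /A mulrC mulrA divff ?gt_eqF// mul1r.
nra.
Qed.

(** When [2 * q < 1] the uncapped series already converges. *)
Lemma capped_geometric_le_lin (q : R) : 0 < q -> 2 * q < 1 ->
  forall N x, 0 <= x ->
  capped_geometric q N x <= (1 - 2 * q)^-1 * x.
Proof.
move=> q0 q1; elim=> [|N IH] x x0.
  by rewrite /capped_geometric big_ord0 mulr_ge0// invr_ge0; lra.
rewrite capped_geometricS.
have h : Num.min x 1 <= x by rewrite ge_min lexx.
have := IH (2 * x) (mulr_ge0 (ler0n R 2) x0); rewrite -(ler_pM2l q0).
set B := (1 - 2 * q)^-1.
have BE : B * (1 - 2 * q) = 1 by rewrite /B mulVf//; lra.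
have : B * (1 - 2 * q) * x = x by rewrite BE mul1r.
nra.
Qed.

End geometric.

(** * Power functions and weighted sums *)

Section powR_lipschitz.
Context {R : realType}.
Implicit Types (a b p M : R).

(** Convexity of the power function, obtained by applying Young's inequality
to [b / a] and [1]. *)
Lemma powR_tangent a b p : 1 < p -> 0 <= b -> b <= a ->
  a `^ p - b `^ p <= p * a `^ (p - 1) * (a - b).
Proof.
move=> p1 b0 ba; have p0 : 0 < p by lra.
have [a0|an0] := eqVneq a 0.
  have -> : b = 0 by lra.
  by rewrite a0 !subrr mulr0.
have a0 : 0 < a by rewrite lt_neqAle eq_sym an0; lra.
pose q := p / (p - 1).
have q0 : 0 < q by rewrite divr_gt0//; lra.
have pq : p^-1 + q^-1 = 1 by rewrite /q; field; apply/andP; split; lra.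
have := conjugate_powR (divr_ge0 b0 (ltW a0)) ler01 p0 q0 pq.
rewrite mulr1 powR1 mul1r.
have -> : (b / a) `^ p = b `^ p / a `^ p.
  by rewrite powRM ?invr_ge0 ?(ltW a0)// -powR_inv1 ?(ltW a0)// -powRrM mulN1r powRN.
have -> : q^-1 = 1 - p^-1 by lra.
have apE : a `^ p = a * a `^ (p - 1) by rewrite mulr_powRB1// ltW.
have A0 : 0 < a `^ (p - 1) by rewrite powR_gt0.
rewrite apE; set A := a `^ (p - 1) in A0 *; set B := b `^ p => h.
have := h; rewrite -(ler_pM2l (mulr_gt0 p0 (mulr_gt0 a0 A0))).
have -> : p * (a * A) * (b / a) = p * A * b by field; rewrite gt_eqF.
have -> : p * (a * A) * (B / (a * A) / p + (1 - p^-1)) = B + (p - 1) * a * A.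
  by field; rewrite !gt_eqF.
by lra.
Qed.

Lemma powR_lipschitz a b p M : 1 < p -> 0 <= a -> a <= M -> 0 <= b -> b <= M ->
  `|a `^ p - b `^ p| <= p * M `^ (p - 1) * `|a - b|.
Proof.
move=> p1; wlog ba : a b / b <= a => [hw a0 aM b0 bM|a0 aM b0 bM].
  have [/hw|/ltW ab] := leP b a; first exact.
  by rewrite distrC (distrC a b); exact: hw.
have p0 : 0 <= p by lra.
rewrite !ger0_norm ?subr_ge0//; last by apply: ge0_ler_powR; rewrite ?nnegrE.
apply: le_trans (powR_tangent p1 b0 ba) _.
rewrite ler_wpM2r ?subr_ge0// ler_wpM2l//.
by apply: ge0_ler_powR; rewrite ?nnegrE//; lra.
Qed.

(** Jensen's inequality for the square and a sub-probability weight, by expanding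
the nonnegative weighted sum of the [(a i - A) ^+ 2] about the mean [A]. *)
Lemma sqr_sum_le_weighted n (a w : nat -> R) : (forall i, (i < n)%N -> 0 <= w i) ->
  \sum_(0 <= i < n) w i <= 1 ->
  (\sum_(0 <= i < n) a i * w i) ^+ 2 <= \sum_(0 <= i < n) a i ^+ 2 * w i.
Proof.
move=> w0 w1; have [A EA] : exists A, A = \sum_(0 <= i < n) a i * w i by eexists.
rewrite -EA.
have : 0 <= \sum_(0 <= i < n) (a i - A) ^+ 2 * w i.
  rewrite big_nat_cond; apply: sumr_ge0 => i /andP[/andP[_ i_n] _].
  by rewrite mulr_ge0 ?sqr_ge0// w0.
have -> : \sum_(0 <= i < n) (a i - A) ^+ 2 * w i =
    \sum_(0 <= i < n) a i ^+ 2 * w i - (2 * A) * A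
      + A ^+ 2 * \sum_(0 <= i < n) w i.
  rewrite [X in _ - X + _]mulrC [X in _ - X * _ + _]EA mulr_suml mulr_sumr -sumrB -big_split/=.
  by apply: eq_bigr => i _; ring.
have := sqr_ge0 A; nra.
Qed.

End powR_lipschitz.

(** * The bounded-difference inequality for fair signs *)

Section sign_average.
Context {R : realType} {I : eqType}.
Implicit Types (s : I -> R) (F G : (I -> R) -> R) (l : seq I).

Definition update s (j : I) (b : R) : I -> R :=
  fun i => if i == j then b else s i.

(** The path estimates hold for all coefficients in the unit cube, which contains
the sign vectors and is stable under substituting signs. *)
Definition in_box s := forall i, `|s i| <= 1.

Lemma in_box_update s j b : in_box s -> `|b| <= 1 -> in_box (update s j b).
Proof. by move=> hs hb i; rewrite /update; case: ifP. Qed.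

Lemma update_comm s i j a b : i != j ->
  update (update s i a) j b = update (update s j b) i a.
Proof.
move=> ij; apply/funext => k; rewrite /update.
by case: (eqVneq k j) => // ->; rewrite eq_sym (negbTE ij).
Qed.

(** Expectation over independent fair signs in the coordinates [l], the other
coordinates being frozen at [s]. *)
Fixpoint sign_average l F s : R :=
  if l is j :: l' then
    (sign_average l' F (update s j 1) + sign_average l' F (update s j (-1))) / 2
  else F s.

Let box1 : `|1| <= 1 :> R. Proof. by rewrite normr1. Qed.
Let boxN1 : `|-1| <= 1 :> R. Proof. by rewrite normrN normr1. Qed.

Lemma expn2_fact_le n : (2 ^ n * n`! <= n.*2`!)%N.
Proof.
elim: n => [//|n IH]; rewrite doubleS !factS expnS mulnACA !mulnA -mulnA.
rewrite leq_mul//; first by rewrite -[X in (X <= _)%N]muln1 leq_mul// -doubleS -mul2n.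
Qed.

(** Compare Taylor coefficients: [2 ^ n * n`! <= (2 * n)`!]. *)
Lemma cosh_le (x : R) : (expR x + expR (- x)) / 2 <= expR (x ^+ 2 / 2).
Proof.
have S y n : series (exp_coeff y) n = \sum_(0 <= k < n) y ^+ k / k`!%:R by [].
have even n : series (exp_coeff x) n.*2 + series (exp_coeff (- x)) n.*2 <=
    2 * series (exp_coeff (x ^+ 2 / 2)) n.
  elim: n => [|n IH]; first by rewrite !S !big_geq// mulr0 addr0.
  rewrite !S doubleS !big_nat_recr//= -!S [leRHS]mulrDr.
  rewrite (exprSr x n.*2) (exprSr (- x) n.*2) -mul2n !exprM sqrrN mul2n expr_div_n.
  set X := (x ^+ 2) ^+ n; have X0 : 0 <= X by rewrite exprn_ge0// sqr_ge0.
  have : X / n.*2`!%:R <= X / 2 ^+ n / n`!%:R.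
    rewrite -mulrA -invfM ler_wpM2l// lef_pV2 ?posrE ?mulr_gt0 ?exprn_gt0 ?ltr0n ?fact_gt0//.
    by rewrite -natrX -natrM ler_nat expn2_fact_le.
  set A := X / n.*2`!%:R; rewrite mulrN mulNr; lra.
have dbl : (fun n => n.*2) @ \oo --> \oo.
  move=> A [N _ NA]; exists N => // n /= Nn; apply: NA => /=.
  by rewrite (leq_trans Nn)// -addnn leq_addr.
have c1 : (fun n => series (exp_coeff x) n.*2 + series (exp_coeff (- x)) n.*2)
    @ \oo --> expR x + expR (- x).
  by apply: cvgD; apply: (cvg_comp _ _ dbl); exact: is_cvg_series_exp_coeff.
have c2 : (fun n => 2 * series (exp_coeff (x ^+ 2 / 2)) n) @ \oo -->
    2 * expR (x ^+ 2 / 2).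
  by apply: cvgM; [exact: cvg_cst|]; exact: is_cvg_series_exp_coeff.
by rewrite ler_pdivrMr// mulrC; apply: (ler_cvg_to c1 c2); exact: nearW.
Qed.

(** Hoeffding's lemma for a fair two-point distribution: after centering, the
left side is a hyperbolic cosine. *)
Lemma two_point_exp (u v lam c : R) : `|u - v| <= c ->
  (expR (lam * u) + expR (lam * v)) / 2
    <= expR (lam * ((u + v) / 2) + lam ^+ 2 * c ^+ 2 / 8).
Proof.
move=> uvc; set h := lam * (u - v) / 2.
have -> : lam * u = lam * ((u + v) / 2) + h by rewrite /h; field.
have -> : lam * v = lam * ((u + v) / 2) - h by rewrite /h; field.
rewrite !expRD -mulrDr -mulrA ler_pM2l ?expR_gt0//.
apply: le_trans (cosh_le h) _; rewrite ler_expR /h.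
have : (u - v) ^+ 2 <= c ^+ 2.
  rewrite -real_normK ?num_real// ler_sqr ?nnegrE//.
  exact: le_trans uvc.
have := sqr_ge0 lam; nra.
Qed.

Lemma sign_average_update l F (c : R) j : j \notin l ->
  (forall s, in_box s -> `|F (update s j 1) - F (update s j (-1))| <= c) ->
  forall s, in_box s ->
  `|sign_average l F (update s j 1) - sign_average l F (update s j (-1))| <= c.
Proof.
move=> + hF; elim: l => [_|i l IH]; first by move=> s /hF.
rewrite inE negb_or => /andP[ji jl] s hs /=.
rewrite ![update (update s j _) i _]update_comm//.
have /(_ _ (in_box_update i hs box1)) := IH jl.
have /(_ _ (in_box_update i hs boxN1)) := IH jl.
rewrite !ler_norml => /andP[? ?] /andP[? ?]; apply/andP; split; lra.
Qed.

(** McDiarmid's bounded-difference inequality. Averaging one coordinate at a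
time, each step costs one two-point Hoeffding factor, because the partial
average still has bounded difference [c j] in the coordinate [j]. *)
Lemma sign_average_exp l F (c : I -> R) (lam : R) : uniq l ->
  (forall j, j \in l -> forall s, in_box s ->
     `|F (update s j 1) - F (update s j (-1))| <= c j) ->
  forall s, in_box s ->
  sign_average l (fun s => expR (lam * F s)) s <=
    expR (lam * sign_average l F s + lam ^+ 2 * (\sum_(j <- l) c j ^+ 2) / 8).
Proof.
elim: l => [|j l IH] /=.
  by move=> _ _ s hs; rewrite big_nil mulr0 mul0r addr0.
move=> /andP[jl ul] hF s hs.
have {}IH := IH ul (fun i il => hF i (@mem_behead _ (j :: l) i il)).
have uvc := sign_average_update jl (hF j (mem_head j l)) hs.
have h1 := IH _ (in_box_update j hs box1).
have h2 := IH _ (in_box_update j hs boxN1).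
have := two_point_exp lam uvc.
move: h1 h2; rewrite big_cons.
set u := sign_average l F _; set v := sign_average l F _.
set S := \sum_(_ <- _) _.
have -> : lam ^+ 2 * (c j ^+ 2 + S) / 8 = lam ^+ 2 * c j ^+ 2 / 8 + lam ^+ 2 * S / 8.
  by field.
rewrite (expRD (lam * u)) (expRD (lam * v)) addrA [in X in _ -> _ -> _ -> X]expRD.
set E := expR (lam ^+ 2 * S / 8) => h1' h2' h3.
have E0 : 0 < E by exact: expR_gt0.
apply: (@le_trans _ _ ((expR (lam * u) + expR (lam * v)) / 2 * E)).
  by rewrite [leRHS]mulrAC ler_pM2r ?invr_gt0// mulrDl; exact: lerD.
by rewrite ler_pM2r.
Qed.

End sign_average.

(** * Hoelder continuity of signed Takagi-Landsberg series *)

Section signed_takagi.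
Context {R : realType}.

Definition schauder_index := {n : nat & 'I_(2 ^ n)}.

Implicit Types (s : schauder_index -> R) (q x y t : R) (N m : nat).

Definition tent_at m (k : nat) t : R := schauder00 (2 ^+ m * t - k%:R).

(** The series truncated to its first [N] levels as a function of the signs, with
[q = 2 `^ (- H)]: the amplitude [2 `^ (m * (1/2 - H))] of level [m] and the
factor [2 `^ (- m/2)] of its Schauder functions combine into [q ^+ m]. *)
Definition signed_takagi q s N t : R :=
  \sum_(m < N) q ^+ m *
    \sum_(k < 2 ^ m) s (Tagged (fun n => 'I_(2 ^ n)) k) * tent_at m k t.

Lemma sum_tent_at_increment m x y : x <= y ->
  \sum_(k < 2 ^ m) `|tent_at m k y - tent_at m k x|
    <= 2 * Num.min (2 ^+ m * (y - x)) 1.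
Proof.
move=> xy; rewrite mulrBr; apply: sum_tent_shift_increment.
by rewrite ler_pM2l// exprn_gt0.
Qed.

Lemma signed_takagi_increment q s N x y : 0 < q -> in_box s -> x <= y ->
  `|signed_takagi q s N y - signed_takagi q s N x|
    <= 2 * capped_geometric q N (y - x).
Proof.
move=> q0 hs xy; rewrite /signed_takagi /capped_geometric -sumrB mulr_sumr.
apply: le_trans (ler_norm_sum _ _ _) _; apply: ler_sum => m _.
rewrite -mulrBr normrM [X in X * _ <= _]gtr0_norm ?exprn_gt0//.
rewrite mulrCA ler_pM2l ?exprn_gt0//.
apply: le_trans (sum_tent_at_increment m xy).
rewrite -sumrB; apply: le_trans (ler_norm_sum _ _ _) _; apply: ler_sum => k _.
by rewrite -mulrBr normrM -[leRHS]mul1r ler_wpM2r.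
Qed.

Lemma signed_takagi_update q s N m (k : 'I_(2 ^ m)) t : (m < N)%N ->
  let j := Tagged (fun n => 'I_(2 ^ n)) k in
  signed_takagi q (update s j 1) N t - signed_takagi q (update s j (-1)) N t =
  2 * q ^+ m * tent_at m k t.
Proof.
move=> mN j; rewrite /signed_takagi -sumrB.
rewrite (bigD1 (Ordinal mN))//= [X in _ + X]big1 ?addr0.
  rewrite -mulrBr -sumrB (bigD1 k)//= [X in _ + X]big1 ?addr0.
    by rewrite /update eqxx; ring.
  by move=> i ik; rewrite /update !eq_Tagged/= (negbTE ik) subrr.
move=> i im; rewrite -mulrBr -sumrB big1 ?mulr0// => l _.
rewrite /update; case: eqP => [E|_]; last by rewrite subrr.
by have /= E2 := congr1 tag E; rewrite -val_eqE/= E2 eqxx in im.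
Qed.

(** Hoelder continuity with a constant uniform in the signs and the truncation:
this is what makes the [p]-th variation with [p = 1 / H] bounded. *)
Lemma signed_takagi_holder H : 0 < H -> H < 1 ->
  exists2 C : R, 0 < C & forall s N x y, in_box s -> 0 <= x -> x <= y -> y <= 1 ->
  `|signed_takagi (2 `^ (- H)) s N y - signed_takagi (2 `^ (- H)) s N x|
    <= C * (y - x) `^ H.
Proof.
move=> H0 H1; have [C C0 hC] := capped_geometric_le H0 H1 erefl.
exists (2 * C) => [|s N x y hs x0 xy y1]; first by rewrite mulr_gt0.
apply: le_trans (signed_takagi_increment _ _ hs xy) _; first by rewrite powR_gt0.
rewrite -mulrA ler_pM2l//; apply: hC; lra.
Qed.

(** This is where the exponent [kappa] comes from. The ratio is
[q ^+ 2 = 2 `^ (- 2 H)]: for [H < 1/2] the sum behaves like [x `^ (2 H)], for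
[H > 1/2] the first level dominates and it is linear in [x]. At [H = 1/2] a
logarithm would appear. *)
Lemma capped_geometric_kappa H : 0 < H -> H < 1 -> H != 2^-1 ->
  let kappa := Num.min 1 (2 - 2 * H) in
  exists2 C : R, 0 < C & forall N x, 0 <= x -> x <= 1 ->
  (x `^ (1 - H)) ^+ 2 * capped_geometric ((2 `^ (- H)) ^+ 2) N x
    <= C * (x `^ kappa * x).
Proof.
move=> H0 H1 H2.
have powsq x : 0 <= x -> (x `^ (1 - H)) ^+ 2 = x `^ (2 - 2 * H).
  by move=> x0; rewrite -powR_mulrn ?powR_ge0// -powRrM; congr powR; ring.
have qE : (2 `^ (- H)) ^+ 2 = 2 `^ (- (2 * H)) :> R.
  by rewrite -powR_mulrn ?powR_ge0// -powRrM; congr powR; ring.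
have [Hh|Hh] := ltP H 2^-1.
  rewrite min_l; last lra.
  have a0 : 0 < 2 * H by lra.
  have a1 : 2 * H < 1 by lra.
  have [C C0 hC] := capped_geometric_le a0 a1 qE.
  exists C => // N x x0 x1; rewrite powsq//.
  apply: (@le_trans _ _ (x `^ (2 - 2 * H) * (C * x `^ (2 * H)))).
    by rewrite ler_wpM2l ?powR_ge0// hC.
  rewrite mulrCA -powRD; last by apply/implyP => /eqP; lra.
  rewrite subrK powRr1// -[in leRHS](@powRr1 _ x)// -powRD; last by apply/implyP => /eqP; lra.
  by have -> : 1 + 1 = 2 :> R by lra.
have {}Hh : 2^-1 < H by rewrite lt_neqAle eq_sym H2.
rewrite min_r; last lra.
have q2 : 2 * (2 `^ (- H)) ^+ 2 < 1 :> R.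
  by rewrite qE double_powR2N powR2N_lt1//; lra.
have q0 : 0 < (2 `^ (- H)) ^+ 2 :> R by rewrite exprn_gt0// powR_gt0.
exists (1 - 2 * (2 `^ (- H)) ^+ 2)^-1; first by rewrite invr_gt0 subr_gt0.
move=> N x x0 x1; rewrite powsq// mulrCA ler_wpM2l ?powR_ge0//.
exact: capped_geometric_le_lin.
Qed.

End signed_takagi.

(** * Sensitivity of the variation to single signs *)

Section variation.
Context {R : realType}.
Variables (H : R) (H_gt0 : 0 < H) (H_lt1 : H < 1) (H_neq : H != 2^-1).

Let p := H^-1.
Let q : R := 2 `^ (- H).
Let kappa := Num.min 1 (2 - 2 * H).

(** A total function on nat makes the sums over consecutive points telescope. *)
Definition is_grid (n : nat) (t : nat -> R) (mu : R) :=
  [/\ t 0%N = 0, t n = 1 & forall i, (i < n)%N -> t i <= t i.+1 /\ t i.+1 - t i <= mu].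

Definition grid_variation (n : nat) (t : nat -> R) N (s : schauder_index -> R) : R :=
  \sum_(0 <= i < n) `|signed_takagi q s N (t i.+1) - signed_takagi q s N (t i)| `^ p.

Lemma grid_bounds n t mu : is_grid n t mu -> forall i, (i <= n)%N -> 0 <= t i <= 1.
Proof.
move=> [t0 tn ti] i i_n; apply/andP; split.
  by elim: i i_n => [|i IH] i_n; rewrite ?t0// (le_trans (IH (ltnW i_n)))// (ti i i_n).1.
rewrite -tn; have {i_n} := subnKC i_n; elim: (n - i)%N {-2}i => [|k IH] j E.
  by rewrite -E addn0.
have jn : (j < n)%N by rewrite -E addnS ltnS leq_addr.
by apply: le_trans (ti j jn).1 (IH _ _); rewrite addSnnS.
Qed.

Lemma sum_grid n t mu : is_grid n t mu -> \sum_(0 <= i < n) (t i.+1 - t i) = 1.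
Proof. by move=> [t0 tn _]; rewrite telescope_sumr// t0 tn subr0. Qed.

Lemma grid_variation_bound : exists2 C : R, 0 <= C & forall n t mu N s,
  is_grid n t mu -> in_box s -> grid_variation n t N s <= C.
Proof.
have [C C0 hC] := signed_takagi_holder H_gt0 H_lt1.
exists (C `^ p); first exact: powR_ge0.
move=> n t mu N s tg hs; have [_ _ ti] := tg.
rewrite -[leRHS]mulr1 -(sum_grid tg) mulr_sumr /grid_variation.
rewrite big_nat_cond [leRHS]big_nat_cond; apply: ler_sum => i /andP[/andP[_ i_n] _].
have /andP[a0 a1] := grid_bounds tg (ltnW i_n).
have /andP[b0 b1] := grid_bounds tg i_n.
have D0 : 0 <= t i.+1 - t i by rewrite subr_ge0 (ti i i_n).1.
apply: (@le_trans _ _ ((C * (t i.+1 - t i) `^ H) `^ p)).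
  apply: ge0_ler_powR; rewrite ?nnegrE ?mulr_ge0 ?powR_ge0 ?invr_ge0 ?(ltW C0) ?(ltW H_gt0)//.
  by apply: hC => //; exact: (ti i i_n).1.
by rewrite powRM ?powR_ge0 ?(ltW C0)// -powRrM mulfV ?gt_eqF// powRr1.
Qed.

(** Up to the constant [K], the effect on the variation of flipping the sign [j]:
the [i]-th summand changes at most by [p * M `^ (p - 1)] times the change of the
increment, where [M] is the Hoelder bound of order [D `^ H] on an interval of
length [D], and [H * (p - 1) = 1 - H]. *)
Definition sensitivity K (n : nat) (t : nat -> R) (j : schauder_index) : R :=
  K * q ^+ tag j * \sum_(0 <= i < n)
    (t i.+1 - t i) `^ (1 - H) *
    `|tent_at (tag j) (tagged j) (t i.+1) - tent_at (tag j) (tagged j) (t i)|.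

Lemma grid_variation_update : exists2 K : R, 0 <= K & forall n t mu N s j,
  is_grid n t mu -> in_box s -> (tag j < N)%N ->
  `|grid_variation n t N (update s j 1) - grid_variation n t N (update s j (-1))|
    <= sensitivity K n t j.
Proof.
have [C C0 hC] := signed_takagi_holder H_gt0 H_lt1.
have p1 : 1 < p by rewrite invf_gt1.
exists (p * C `^ (p - 1) * 2); first by rewrite !mulr_ge0 ?powR_ge0//; lra.
move=> n t mu N s [m k] tg hs mN; have [_ _ ti] := tg.
rewrite /grid_variation -sumrB; apply: le_trans (ler_norm_sum _ _ _) _.
rewrite /sensitivity mulr_sumr big_nat_cond [leRHS]big_nat_cond.
apply: ler_sum => i /andP[/andP[_ i_n] _] /=.
have /andP[a0 a1] := grid_bounds tg (ltnW i_n).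
have /andP[b0 b1] := grid_bounds tg i_n.
have D0 : 0 <= t i.+1 - t i by rewrite subr_ge0 (ti i i_n).1.
have bx b : `|b| <= 1 -> in_box (update s (Tagged (fun n => 'I_(2 ^ n)) k) b).
  exact: in_box_update.
have b1' : `|1| <= 1 :> R by rewrite normr1.
have bm1' : `|-1| <= 1 :> R by rewrite normrN normr1.
set j : schauder_index := existT _ m k.
set x1 := signed_takagi q (update s j 1) N (t i.+1) - _.
set x2 := signed_takagi q (update s j (-1)) N (t i.+1) - _.
have xE : x1 - x2 = 2 * q ^+ m * (tent_at m k (t i.+1) - tent_at m k (t i)).
  rewrite mulrBr -!(signed_takagi_update q s k _ mN)/= -/j /x1 /x2; ring.
apply: le_trans (powR_lipschitz (M := C * (t i.+1 - t i) `^ H) p1 _ _ _ _) _ => //.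
- by apply: hC => //; [exact: bx|exact: (ti i i_n).1].
- by apply: hC => //; [exact: bx|exact: (ti i i_n).1].
rewrite powRM ?powR_ge0 ?(ltW C0)// -powRrM.
have -> : H * (p - 1) = 1 - H by rewrite /p; field; rewrite gt_eqF.
apply: (@le_trans _ _ (p * (C `^ (p - 1) * (t i.+1 - t i) `^ (1 - H)) * `|x1 - x2|)).
  rewrite ler_wpM2l// ?mulr_ge0 ?powR_ge0//; first lra.
  exact: ler_dist_dist.
rewrite xE !normrM normr_nat (ger0_norm (_ : 0 <= q ^+ m)); last first.
  by rewrite exprn_ge0 ?powR_ge0.
by rewrite le_eqVlt; apply/orP; left; apply/eqP; ring.
Qed.

Definition indices_below (N : nat) : seq schauder_index :=
  [seq Tagged (fun n => 'I_(2 ^ n)) k | m <- iota 0 N, k <- enum 'I_(2 ^ m)].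

Lemma mem_indices_below N j : (j \in indices_below N) = (tag j < N)%N.
Proof.
apply/allpairsPdep/idP => [[m [k [mN _ ->]]]|jN] /=; first by move: mN; rewrite mem_iota.
by exists (tag j), (tagged j); rewrite mem_iota jN mem_enum; split=> //; case: j jN.
Qed.

Lemma uniq_indices_below N : uniq (indices_below N).
Proof.
apply: allpairs_uniq_dep; [exact: iota_uniq|by move=> *; exact: enum_uniq|].
by move=> [m k] [m' k'] _ _ /=.
Qed.

(** The increments of one tent over a partition sum to at most 1, so Jensen's
inequality bounds each squared sensitivity by a sum over intervals that is
linear in the tent increments. Exchanging the sums, the tent increments of a
level add up to at most [2 * min(2 ^ m * D, 1)] on an interval of length [D], the
levels add up to a capped geometric sum, and what remains is at most [mu `^ kappa] times the total
length 1. *)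
Lemma sum_sqr_sensitivity K : exists2 C : R, 0 < C & forall n t mu N,
  is_grid n t mu ->
  \sum_(j <- indices_below N) sensitivity K n t j ^+ 2 <= C * mu `^ kappa.
Proof.
have [C C0 hC] := capped_geometric_kappa H_gt0 H_lt1 H_neq.
(* Adding 1 to the square of [K] keeps the constant positive when [K = 0]. *)
exists (2 * (K ^+ 2 + 1) * C); first by rewrite !mulr_gt0// ltr_wpDl ?sqr_ge0.
move=> n t mu N tg; have [_ _ ti] := tg.
pose D i := t i.+1 - t i.
pose tau m k i := `|tent_at m k (t i.+1) - tent_at m k (t i)|.
have tau1 m k : \sum_(0 <= i < n) tau m k i <= 1.
  apply: (sum_tent_increment (u := fun i => 2 ^+ m * t i - k%:R)) => i i_n.
  by rewrite lerD2r ler_pM2l ?exprn_gt0// (ti i i_n).1.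
have Kq m : 0 <= K ^+ 2 * (q ^+ 2) ^+ m.
  by apply: mulr_ge0; [exact: sqr_ge0|apply: exprn_ge0; exact: sqr_ge0].
rewrite /indices_below big_allpairs_dep.
apply: (@le_trans _ _ (\sum_(m <- iota 0 N) \sum_(k <- enum 'I_(2 ^ m))
   K ^+ 2 * (q ^+ 2) ^+ m * \sum_(0 <= i < n) (D i `^ (1 - H)) ^+ 2 * tau m k i)).
  apply: ler_sum => m _; apply: ler_sum => k _.
  rewrite /sensitivity/= exprMn [X in X * _ <= _]exprMn (exprAC q m 2).
  rewrite ler_wpM2l ?Kq//.
  by apply: (@sqr_sum_le_weighted _ n (fun i => D i `^ (1 - H)) (tau m k)) => // i _;
    exact: normr_ge0.
apply: (@le_trans _ _ (2 * K ^+ 2 * \sum_(0 <= i < n)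
   (D i `^ (1 - H)) ^+ 2 * capped_geometric (q ^+ 2) N (D i))).
  rewrite -[N in iota _ N]subn0 -/(index_iota _ _) big_mkord.
  under eq_bigr => m _ do rewrite big_enum/= -mulr_sumr exchange_big/=.
  rewrite [X in _ <= _ * X](_ : _ = \sum_(m < N) \sum_(0 <= i < n)
      (D i `^ (1 - H)) ^+ 2 * ((q ^+ 2) ^+ m * Num.min (2 ^+ m * D i) 1)); last first.
    by rewrite exchange_big/=; apply: eq_bigr => i _; rewrite -mulr_sumr.
  rewrite mulr_sumr; apply: ler_sum => m _.
  rewrite !mulr_sumr big_nat_cond [leRHS]big_nat_cond.
  apply: ler_sum => i /andP[/andP[_ i_n] _].
  rewrite -mulr_sumr.
  have := sum_tent_at_increment m (ti i i_n).1.
  rewrite -/(D i); set S := \sum_(k < _) _; set W := Num.min _ _ => SW.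
  rewrite [leRHS](_ : _ =
    K ^+ 2 * (q ^+ 2) ^+ m * ((D i `^ (1 - H)) ^+ 2 * (2 * W))); last by ring.
  by rewrite ler_wpM2l ?Kq// ler_wpM2l ?sqr_ge0.
apply: (@le_trans _ _ (2 * K ^+ 2 * \sum_(0 <= i < n) C * (mu `^ kappa * D i))).
  rewrite ler_wpM2l//; first by apply: mulr_ge0; rewrite ?sqr_ge0.
  rewrite big_nat_cond [leRHS]big_nat_cond.
  apply: ler_sum => i /andP[/andP[_ i_n] _].
  have /andP[a0 a1] := grid_bounds tg (ltnW i_n).
  have /andP[b0 b1] := grid_bounds tg i_n.
  have D0 : 0 <= D i by rewrite subr_ge0 (ti i i_n).1.
  apply: le_trans (hC _ _ D0 _) _; first by rewrite /D; lra.
  rewrite ler_pM2l// ler_wpM2r//; have Dmu := (ti i i_n).2.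
  apply: ge0_ler_powR; rewrite ?nnegrE//; last exact: le_trans Dmu.
  by rewrite /kappa le_min ler01 subr_ge0 -[leRHS]mulr1 ler_pM2l ?ltr0n ?(ltW H_lt1).
rewrite -mulr_sumr -mulr_sumr (sum_grid tg) mulr1 mulrA ler_wpM2r ?powR_ge0//.
by rewrite ler_wpM2r ?(ltW C0)// ler_wpM2l// lerDl.
Qed.

End variation.

(** * The law of independent Rademacher variables *)

Section rademacher_law.
Context (d : measure_display) (T : measurableType d) (R : realType).
Variables (P : probability T R) (I : choiceType) (theta : I -> {RV P >-> R}).
Hypothesis theta_rademacher : forall i, rademacher (theta i).
Hypothesis theta_indep : mutually_independent theta.

Definition sign_vector (s : I -> R) := forall i, s i = 1 \/ s i = -1.

Lemma sign_vector_box s : sign_vector s -> in_box s.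
Proof. by move=> hs i; case: (hs i) => ->; rewrite ?normrN normr1. Qed.

Lemma sign_vector_update s j b : sign_vector s -> b = 1 \/ b = -1 ->
  sign_vector (update s j b).
Proof. by move=> hs hb i; rewrite /update; case: ifP. Qed.

Definition cylinder (J : {fset I}) (s : I -> R) : set T :=
  \bigcap_(i in [set` J]) (theta i @^-1` [set s i]).

Lemma measurable_theta_eq i b : measurable (theta i @^-1` [set b]).
Proof. by rewrite -[X in measurable X]setTI; exact: measurable_funP. Qed.

Lemma measurable_cylinder J s : measurable (cylinder J s).
Proof.
apply: fin_bigcap_measurable => [|i _]; first exact: finite_fset.
exact: measurable_theta_eq.
Qed.

Lemma prob_cylinder J s : sign_vector s ->
  P (cylinder J s) = ((2^-1) ^+ #|` J|)%:E.
Proof.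
move=> hs; rewrite /cylinder (theta_indep J (B := fun i => [set s i])); last first.
  by move=> i; exact: measurable_set1.
rewrite (eq_bigr (fun=> (2^-1)%:E)); last first.
  by move=> i _; case: (hs i) => ->; have [] := theta_rademacher i.
by rewrite prodEFin big_const_seq count_predT iter_mulr_1.
Qed.

(** Integrating over a cylinder averages the free coordinates. Induction on the
list of free coordinates: a cylinder splits, up to a null set, into the two
cylinders fixing one more sign, each of half its probability. *)
Lemma integral_cylinder l J s (G : (I -> R) -> R) :
  sign_vector s -> uniq l -> (forall i, i \in l -> i \notin J) ->
  measurable_fun setT (fun w => G (fun i => theta i w)) -> (forall s', 0 <= G s') ->
  (forall s1 s2, (forall i, (i \in J) || (i \in l) -> s1 i = s2 i) -> G s1 = G s2) ->
  (\int[P]_(w in cylinder J s) (G (fun i => theta i w))%:E)%E =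
    ((2^-1) ^+ #|` J| * sign_average l G s)%:E.
Proof.
move=> hs ul lJ mG G0 dG.
elim: l J s hs ul lJ dG => [|j l IH] J s hs + lJ dG.
  move=> _ /=; rewrite (eq_integral (cst (G s)%:E)).
    rewrite integral_cst; last exact: measurable_cylinder.
    by rewrite [X in (_ * X)%E](prob_cylinder J hs) -EFinM mulrC.
  move=> w; rewrite inE => Aw; rewrite (dG _ s)// => i; rewrite orbF => iJ.
  exact: Aw.
move=> /= /andP[jl ul].
have jJ : j \notin J by apply: lJ; rewrite mem_head.
have cylE b : cylinder (j |` J)%fset (update s j b) =
    cylinder J s `&` (theta j @^-1` [set b]).
  apply/seteqP; split=> w /=.
    move=> h; split.
      move=> i /= iJ; have /= := h i; rewrite !inE iJ orbT => /(_ isT) ->.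
      by rewrite /update; case: eqVneq => // ij; move: jJ; rewrite -ij iJ.
    by have /= := h j; rewrite !inE eqxx => /(_ isT) ->; rewrite /update eqxx.
  move=> [h1 h2] i /=; rewrite !inE /update; case: eqVneq => [-> //|_ /= iJ].
  exact: h1.
have IHb b : b = 1 \/ b = -1 ->
  (\int[P]_(w in cylinder J s `&` (theta j @^-1` [set b])) (G (fun i => theta i w))%:E)%E =
  ((2^-1) ^+ #|` J|.+1 * sign_average l G (update s j b))%:E.
  move=> hb; rewrite -cylE IH//.
  - by rewrite cardfsU1 jJ.
  - exact: sign_vector_update.
  - move=> i il; rewrite !inE negb_or; apply/andP; split.
      by apply: contraNneq jl => <-.
    by apply: lJ; rewrite inE il orbT.
  - move=> s1 s2 h; apply: dG => i hi; apply: h; move: hi.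
    by rewrite !inE => /or3P[->|->|->]; rewrite ?orbT.
have mA := measurable_cylinder J s.
have m1 := measurable_theta_eq j 1; have mN := measurable_theta_eq j (-1).
pose A1 := cylinder J s `&` (theta j @^-1` [set 1]).
pose A2 := cylinder J s `&` (theta j @^-1` [set -1]).
have mA1 : measurable A1 by exact: measurableI.
have mA2 : measurable A2 by exact: measurableI.
have dA : [disjoint A1 & A2].
  apply/disj_setPS => w [[_ /= w1] [_ /= w2]].
  have : (1 : R) = -1 by rewrite -{1}w1 w2.
  by lra.
have mGE (D : set T) : measurable_fun D (EFin \o (fun w => G (fun i => theta i w))).
  by apply/measurable_EFinP; exact: measurable_funTS.
have PA1 : P A1 = ((2^-1) ^+ #|` J|.+1)%:E.
  rewrite /A1 -cylE prob_cylinder; last by apply: sign_vector_update => //; left.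
  by rewrite cardfsU1 jJ.
have PA2 : P A2 = ((2^-1) ^+ #|` J|.+1)%:E.
  rewrite /A2 -cylE prob_cylinder; last by apply: sign_vector_update => //; right.
  by rewrite cardfsU1 jJ.
have P0 : P (cylinder J s `\` (A1 `|` A2)) = 0%E.
  rewrite measureD//; last 2 first.
  - exact: measurableU.
  - by apply: le_lt_trans (probability_le1 P mA) (ltry _).
  rewrite setIUr !setIA setIid -/A1 -/A2 measureU//; last exact/eqP/dA.
  rewrite [X in (X - (_ + _))%E](prob_cylinder J hs).
  rewrite [X in (_ - (X + _))%E]PA1 [X in (_ - (_ + X))%E]PA2.
  by rewrite -[X in (_ - X)%E]EFinD -EFinB exprS; congr _%:E; field.
have GE0 (D : set T) w : D w -> (0 <= (EFin \o (fun w => G (fun i => theta i w))) w)%E.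
  by move=> _; rewrite lee_fin.
apply: etrans (ge0_negligible_integral (mu := P) _ mA (mGE _) (GE0 _) P0) _.
  by apply: measurableD => //; exact: measurableU.
rewrite setDD setIUr !setIA setIid -/A1 -/A2.
apply: etrans (ge0_integral_setU P mA1 mA2 (mGE _) (GE0 _) dA) _.
rewrite [X in (X + _)%E](IHb 1); last by left.
rewrite [X in (_ + X)%E](IHb (-1)); last by right.
by rewrite -EFinD exprS; congr _%:E; field.
Qed.

Lemma expectation_sign_average l s (G : (I -> R) -> R) :
  sign_vector s -> uniq l ->
  measurable_fun setT (fun w => G (fun i => theta i w)) -> (forall s', 0 <= G s') ->
  (forall s1 s2, (forall i, i \in l -> s1 i = s2 i) -> G s1 = G s2) ->
  (\int[P]_w (G (fun i => theta i w))%:E)%E = (sign_average l G s)%:E.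
Proof.
move=> hs ul mG G0 dG.
have := @integral_cylinder l fset0 s G hs ul _ mG G0.
rewrite cardfs0 expr0 mul1r (_ : cylinder fset0 s = setT); last first.
  by apply/seteqP; split=> // w _ i /=; rewrite inE.
apply=> // s1 s2 h; apply: dG => i il; apply: h; rewrite il orbT//.
Qed.

(** McDiarmid's inequality on the probability space: by independence, the mean
and the exponential moment of a function of finitely many signs are both sign
averages, taken here at the all-ones vector. *)
Lemma expectation_exp_le l (F : (I -> R) -> R) (c : I -> R) (K lam : R) : uniq l ->
  (forall j, j \in l -> forall s, in_box s ->
     `|F (update s j 1) - F (update s j (-1))| <= c j) ->
  \sum_(j <- l) c j ^+ 2 <= K ->
  measurable_fun setT (fun w => F (fun i => theta i w)) -> (forall s, 0 <= F s) ->
  (forall s1 s2, (forall i, i \in l -> s1 i = s2 i) -> F s1 = F s2) ->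
  (\int[P]_w (expR (lam * F (fun i => theta i w)))%:E <=
   (expR (lam * fine (\int[P]_w (F (fun i => theta i w))%:E) + lam ^+ 2 * K / 8))%:E)%E.
Proof.
move=> ul hF hc mF F0 dF.
have s1 : sign_vector (fun=> 1 : R) by left.
rewrite (expectation_sign_average s1 ul mF F0 dF)/=.
rewrite (expectation_sign_average (G := fun s => expR (lam * F s)) s1 ul)//; last first.
- by move=> s s' h; rewrite (dF s s').
- by apply: measurableT_comp => //; exact: measurable_funM.
rewrite lee_fin; apply: le_trans (sign_average_exp lam ul hF (sign_vector_box s1)) _.
rewrite ler_expR lerD2l ler_pM2r ?invr_gt0// ler_wpM2l// sqr_ge0//.
Qed.

End rademacher_law.

(** * Limits of random variables and sub-Gaussian tails *)

Section measurable_limit.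
Context (d : measure_display) (T : measurableType d) (R : realType).

Lemma measurable_cvgn (f : nat -> T -> R) :
  (forall n, measurable_fun setT (f n)) ->
  measurable [set w | cvgn (fun n => f n w)].
Proof.
move=> mf.
have -> : [set w | cvgn (fun n => f n w)] =
    \bigcap_k \bigcup_N \bigcap_j
      [set w | `|f (N + j)%N w - f N w| < k.+1%:R^-1].
  apply/seteqP; split=> w /=.
    move=> /cvg_ex[l fl] k _.
    have k0 : (0 : R) < k.+1%:R^-1 / 2 by rewrite divr_gt0 ?invr_gt0.
    have /cvgr_distC_lt /(_ _ k0) [N _ hN] := fl.
    exists N => // j _ /=.
    have /= h1 := hN N (leqnn N); have /= h2 := hN (N + j)%N (leq_addr j N).
    have -> : f (N + j)%N w - f N w = (f (N + j)%N w - l) - (f N w - l) by ring.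
    by apply: le_lt_trans (ler_normB _ _) _; rewrite [ltRHS]splitr ltrD.
  move=> h; apply/cauchy_cvgP; apply: cauchy_exP => e e0.
  have [k ke] : exists k, k.+1%:R^-1 < e :> R.
    have := @cvg_harmonic R => /cvgr_lt /(_ _ e0) [k _ hk].
    by exists k; exact: (hk k (leqnn k)).
  have [N _ hN] := h k I; exists (f N w); exists N => // n /= Nn.
  have := hN (n - N)%N I; rewrite /= subnKC// => hn.
  by rewrite /ball/= distrC; apply: lt_trans ke.
apply: bigcap_measurableType => k _; apply: bigcup_measurable => N _.
apply: bigcap_measurableType => j _.
rewrite [X in measurable X](_ : _ =
  (fun w => `|f (N + j)%N w - f N w|) @^-1` `]-oo, k.+1%:R^-1[); last first.
  by apply/seteqP; split=> w /=; rewrite in_itv.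
rewrite -[X in measurable X]setTI.
have : measurable_fun setT (fun w => `|f (N + j)%N w - f N w|).
  by apply: measurableT_comp => //; exact: measurable_funB.
by apply.
Qed.

(** On the measurable set where the sequence converges this is a pointwise limit;
elsewhere [limn] is a fixed default value. *)
Lemma measurable_limn (f : nat -> T -> R) :
  (forall n, measurable_fun setT (f n)) ->
  measurable_fun setT (fun w => limn (fun n => f n w)).
Proof.
move=> mf; have mC := measurable_cvgn mf.
rewrite -(setUv [set w | cvgn (fun n => f n w)]).
apply/measurable_funU => //; first exact: measurableC.
split.
  apply: (@measurable_fun_cvg _ _ _ _ f) => // n; exact: measurable_funTS.
apply: (eq_measurable_fun (cst point)) => [w|]; last exact: measurable_cst.
by rewrite inE => /dvgP ->.
Qed.

End measurable_limit.

Section bounded_convergence.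
Context (d : measure_display) (T : measurableType d) (R : realType).
Variable (P : probability T R).

Lemma bounded_convergence (f : nat -> T -> R) (g : T -> R) (C : R) :
  (forall n, measurable_fun setT (f n)) -> measurable_fun setT g ->
  {ae P, forall w, f n w @[n --> \oo] --> g w} ->
  {ae P, forall w n, `|f n w| <= C} ->
  P.-integrable setT (EFin \o g) /\
  (\int[P]_w (f n w)%:E)%E @[n --> \oo] --> (\int[P]_w (g w)%:E)%E.
Proof.
move=> mf mg fg fC.
have [|||||//] := @dominated_convergence _ _ _ P setT measurableT
  (fun n => EFin \o f n) (EFin \o g) (cst C%:E).
- by move=> n; exact/measurable_EFinP.
- exact/measurable_EFinP.
- apply: filterS fg => w h _ /=.
  by apply: cvg_EFin h; exact: nearW.
- exact: finite_measure_integrable_cst.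
- by apply: filterS fC => w h n _ /=; rewrite lee_fin.
Qed.

End bounded_convergence.

Lemma cvg_powR (R : realType) (a : nat -> R) (l M p : R) : 1 < p ->
  (forall n, 0 <= a n <= M) -> 0 <= l <= M -> a @ \oo --> l ->
  a n `^ p @[n --> \oo] --> l `^ p.
Proof.
move=> p1 aM /andP[l0 lM] al; apply/cvgrPdistC_le => e e0.
pose K := p * M `^ (p - 1) + 1.
have K0 : 0 < K by rewrite ltr_wpDl// mulr_ge0 ?powR_ge0//; lra.
have /cvgr_distC_le /(_ _ (divr_gt0 e0 K0)) := al.
apply: filterS => n h; have /andP[a0 a1] := aM n.
apply: le_trans (powR_lipschitz p1 a0 a1 l0 lM) _.
apply: (@le_trans _ _ (K * `|a n - l|)); first by rewrite ler_wpM2r// /K lerDl.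
by rewrite mulrC -ler_pdivlMr.
Qed.

Section tail.
Context (d : measure_display) (T : measurableType d) (R : realType).
Variable (P : probability T R).

(** Sub-Gaussian tails: Chernoff's bound for [X] and [- X] at the optimal
parameter [4 * t / K]. *)
Lemma chernoff_tail (X : T -> R) (m K t : R) : measurable_fun setT X ->
  0 < K -> 0 < t ->
  (forall lam, (\int[P]_w (expR (lam * X w))%:E
                 <= (expR (lam * m + lam ^+ 2 * K / 8))%:E)%E) ->
  (P [set w | (t <= `|X w - m|)%R] <= (2 * expR (- (2 * t ^+ 2 / K)))%:E)%E.
Proof.
move=> mX K0 t0 hX; pose r := 4 * t / K.
have r0 : 0 < r by rewrite divr_gt0// mulr_gt0.
have half (Y : T -> R) a : measurable_fun setT Y ->
    (\int[P]_w (expR (r * Y w))%:E <= (expR (r * a + r ^+ 2 * K / 8))%:E)%E ->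
    (P [set w | (a + t <= Y w)%R] <= (expR (- (2 * t ^+ 2 / K)))%:E)%E.
  move=> mY hY.
  pose Z : {RV P >-> R} := mfun_Sub (mem_set mY).
  apply: le_trans (chernoff Z (a + t) r0) _.
  rewrite /mmt_gen_fun unlock.
  apply: (@le_trans _ _ ((expR (r * a + r ^+ 2 * K / 8))%:E * (expR (- (r * (a + t))))%:E)%E).
    apply: lee_wpmul2r; first by rewrite lee_fin expR_ge0.
    apply: le_trans hY; rewrite le_eqVlt; apply/orP; left; apply/eqP.
    by apply: eq_integral => w _ /=; rewrite mulrC.
  rewrite -EFinM -expRD lee_fin ler_expR le_eqVlt; apply/orP; left; apply/eqP.
  by rewrite /r; field; rewrite gt_eqF.
have mN : measurable_fun setT (fun w => - X w) by exact: measurableT_comp.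
have h1 := half X m mX (hX r).
have h2 : (P [set w | (- m + t <= - X w)%R] <= (expR (- (2 * t ^+ 2 / K)))%:E)%E.
  apply: half => //; have := hX (- r).
  by rewrite sqrrN mulNr -mulrN; under eq_integral do rewrite mulNr -mulrN.
have mge (Y : T -> R) a : measurable_fun setT Y -> measurable [set w | a <= Y w].
  move=> mY; rewrite [X in measurable X](_ : _ = Y @^-1` `[a, +oo[); last first.
    by apply/seteqP; split=> w /=; rewrite in_itv/= andbT.
  by rewrite -[X in measurable X]setTI; exact: mY.
rewrite [X in P X](_ : _ = [set w | m + t <= X w] `|` [set w | - m + t <= - X w]).
  apply: le_trans (measureU2 _ _ _) _; [exact: mge|exact: mge|].
  by rewrite mulr_natl mulr2n EFinD; exact: leeD.
apply/seteqP; split=> w /=.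
  by rewrite ler_normr => /orP[h|h]; [left|right]; lra.
by rewrite ler_normr => -[h|h]; apply/orP; [left|right]; lra.
Qed.

End tail.

(** * The random bridge *)

(** Normal convergence: every dyadic level is bounded by [q ^+ m]. *)
Lemma cvg_signed_takagi (R : realType) (q : R) s t : 0 < q -> q < 1 -> in_box s ->
  cvgn (fun N => signed_takagi q s N t).
Proof.
move=> q0 q1 hs.
pose u m : R := q ^+ m * \sum_(k < 2 ^ m) s (Tagged (fun n => 'I_(2 ^ n)) k) * tent_at m k t.
have -> : (fun N => signed_takagi q s N t) = series u.
  by apply/funext => N; rewrite /series/= big_mkord.
apply: normed_cvg.
apply: (@series_le_cvg _ _ (geometric 1 q)) => [m|m|m|].
- exact: normr_ge0.
- by rewrite /geometric/= mul1r exprn_ge0// ltW.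
- rewrite /geometric/= mul1r /u normrM ger0_norm ?exprn_ge0 ?(ltW q0)//.
  rewrite -[leRHS]mulr1 ler_wpM2l ?exprn_ge0 ?(ltW q0)//.
  apply: le_trans (ler_norm_sum _ _ _) _.
  apply: le_trans (sum_tent_shift (2 ^ m) (2 ^+ m * t)); apply: ler_sum => k _.
  rewrite normrM (ger0_norm (tent_ge0 _)) -[leRHS]mul1r ler_wpM2r//.
  exact: tent_ge0.
- by apply: is_cvg_geometric_series; rewrite ger0_norm ?(ltW q0).
Qed.

Lemma cvg_expR (R : realType) (u : nat -> R) (l : R) :
  u @ \oo --> l -> expR (u n) @[n --> \oo] --> expR l.
Proof. by move=> ul; apply: (continuous_cvg _ _ ul); exact: continuous_expR. Qed.

Lemma itv_partition_grid (R : realType) (s : seq R) : itv_partition 0 1 s ->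
  is_grid (size s) (fun i => (0 :: s)`_i) (mesh s).
Proof.
move=> [ps /eqP ls]; split => //.
  by rewrite -[size s]/(size (0 :: s)).-1 nth_last.
move=> i i_s; split.
  by apply: ltW; have /pathP := ps => /(_ 0 i i_s).
rewrite /mesh big_mkord.
exact: (le_bigmax _ (fun i : 'I_(size s) => (0 :: s)`_i.+1 - (0 :: s)`_i) (Ordinal i_s)).
Qed.

Lemma mesh_ge0 (R : realType) (s : seq R) : 0 <= mesh s.
Proof. by rewrite /mesh big_mkord; exact: bigmax_ge_id. Qed.

Section process.
Context (R : realType) (d : measure_display) (T : measurableType d).
Variables (P : probability T R) (theta : forall n : nat, 'I_(2 ^ n) -> {RV P >-> R}).
Hypothesis htheta : independent_rademacher theta.
Variables (H : R) (H_gt0 : 0 < H) (H_lt1 : H < 1) (H_neq : H != 2^-1).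

Let q : R := 2 `^ (- H).
Let p := H^-1.
Let kappa := Num.min 1 (2 - 2 * H).

(** The given doubly indexed family, seen as one family over pairs of a level and a
position. *)
Definition signs (j : schauder_index) : {RV P >-> R} := theta (tagged j).

Let sgn w : schauder_index -> R := fun j => signs j w.

Lemma takagi_landsbergE t w :
  takagi_landsberg H theta t w = limn (fun N => signed_takagi q (sgn w) N t).
Proof.
rewrite /takagi_landsberg; congr (lim _); congr (_ @ \oo); apply/funext => N.
rewrite /series/= big_mkord; apply: eq_bigr => m _.
rewrite !mulr_sumr; apply: eq_bigr => k _.
have -> : q ^+ m = 2 `^ (m%:R * (2^-1 - H)) * 2 `^ (- (m%:R / 2)) :> R.
  rewrite -powRD ?pnatr_eq0 ?implybT// -powR_mulrn ?powR_ge0// -powRrM.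
  by congr powR; field.
rewrite /schauder /sgn /signs /tent_at/=; ring.
Qed.

Lemma measurable_signed_takagi N t :
  measurable_fun setT (fun w => signed_takagi q (sgn w) N t).
Proof.
apply: measurable_sum => m; apply: measurable_funM => //.
by apply: measurable_sum => k; exact: measurable_funM.
Qed.

(** The deviation events must be measurable as they stand, so the null set where
the series may diverge cannot be discarded here. *)
Lemma measurable_takagi t : measurable_fun setT (takagi_landsberg H theta t).
Proof.
rewrite (_ : takagi_landsberg H theta t =
  fun w => limn (fun N => signed_takagi q (sgn w) N t)); last first.
  by apply/funext => w; exact: takagi_landsbergE.
by apply: measurable_limn => N; exact: measurable_signed_takagi.
Qed.

Lemma measurable_pvariation (r : R) (s : seq R) (x : R -> T -> R) :
  (forall t, measurable_fun setT (x t)) ->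
  measurable_fun setT (fun w => pvariation r s (fun t => x t w)).
Proof.
move=> mx; rewrite /pvariation; apply: measurable_sum => i.
apply: (measurableT_comp (f := @powR R ^~ r)); first exact: measurable_powR.
by apply: measurableT_comp => //; exact: measurable_funB.
Qed.

Lemma ae_sign : {ae P, forall w, sign_vector (sgn w)}.
Proof.
have aeI (j : schauder_index) : {ae P, forall w, sgn w j = 1 \/ sgn w j = -1}.
  have [h1 h2] := htheta.1 _ (tagged j).
  have m1 b : measurable (signs j @^-1` [set b]).
    by rewrite -[X in measurable X]setTI; exact: measurable_funP.
  exists (~` (signs j @^-1` [set 1] `|` signs j @^-1` [set -1])); split.
  - by apply: measurableC; exact: measurableU.
  - rewrite probability_setC; last exact: measurableU.
    rewrite measureU//; last first.
      apply/seteqP; split=> w //= [w1 w2]; have : (1 : R) = -1 by rewrite -{1}w1 w2.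
      by lra.
    rewrite [X in (1 - (X + _))%E]h1 [X in (1 - (_ + X))%E]h2.
    have -> : ((2^-1)%:E + (2^-1)%:E = 1%:E :> \bar R)%E by rewrite -EFinD; congr _%:E; field.
    by rewrite subee.
  - by move=> w /= h hn; apply: h.
have : {ae P, forall w (n : nat), if (@choice.unpickle {m : nat & 'I_(2 ^ m)} n) is Some j then sgn w j = 1 \/ sgn w j = -1 else True}.
  apply/ae_foralln => n; case: (@choice.unpickle {m : nat & 'I_(2 ^ m)} n) => [j|]; first exact: aeI.
  exact: nearW.
by apply: filterS => w h j; have := h (choice.pickle j); rewrite choice.pickleK.
Qed.

Let V s w := pvariation p s (fun t => takagi_landsberg H theta t w).
Let VN s N w := grid_variation H (size s) (fun i => (0 :: s)`_i) N (sgn w).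

Lemma measurable_takagi_variation s : measurable_fun setT (V s).
Proof. by apply: measurable_pvariation => t; exact: measurable_takagi. Qed.

Lemma measurable_truncated_variation s N : measurable_fun setT (VN s N).
Proof.
rewrite /VN /grid_variation.
exact: (measurable_pvariation p s (measurable_signed_takagi N)).
Qed.

Lemma cvg_truncated_variation s w : itv_partition 0 1 s -> in_box (sgn w) -> VN s N w @[N --> \oo] --> V s w.
Proof.
move=> /itv_partition_grid sg hw; have [_ _ ti] := sg.
have [C C0 hC] := signed_takagi_holder H_gt0 H_lt1.
have p1 : 1 < p by rewrite invf_gt1.
have cX t : signed_takagi q (sgn w) N t @[N --> \oo] --> takagi_landsberg H theta t w.
  by rewrite takagi_landsbergE; exact: (cvg_signed_takagi (powR_gt0 _ (ltr0n R 2)) (powR2N_lt1 H_gt0) hw).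
rewrite /VN /V /grid_variation /pvariation.
rewrite big_nat_cond; under eq_fun do rewrite big_nat_cond.
apply: cvg_big => [|i]; first exact: add_continuous.
move=> /andP[/andP[_ i_s] _].
have /andP[a0 a1] := grid_bounds sg (ltnW i_s).
have /andP[b0 b1] := grid_bounds sg i_s.
set M := C * ((0 :: s)`_i.+1 - (0 :: s)`_i) `^ H.
have cD : `|signed_takagi q (sgn w) N (0 :: s)`_i.+1 - signed_takagi q (sgn w) N (0 :: s)`_i|
    @[N --> \oo] --> `|takagi_landsberg H theta (0 :: s)`_i.+1 w
      - takagi_landsberg H theta (0 :: s)`_i w|.
  by apply: cvg_norm; apply: cvgB; exact: cX.
have bD N : 0 <= `|signed_takagi q (sgn w) N (0 :: s)`_i.+1 - signed_takagi q (sgn w) N (0 :: s)`_i| <= M.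
  by rewrite normr_ge0 hC//; exact: (ti i i_s).1.
apply: (cvg_powR p1 bD _ cD); rewrite normr_ge0/=.
by apply: (ler_cvg_to cD (cvg_cst M)); apply: nearW => N; have /andP[] := bD N.
Qed.

Lemma signed_takagi_ext s1 s2 N t :
  (forall j, j \in indices_below N -> s1 j = s2 j) ->
  signed_takagi q s1 N t = signed_takagi q s2 N t.
Proof.
move=> h; apply: eq_bigr => m _; congr (_ * _); apply: eq_bigr => k _.
by rewrite h// mem_indices_below/=.
Qed.

Lemma mutually_independent_signs : mutually_independent signs.
Proof. exact: htheta.2. Qed.

(** The finite-dimensional bound for truncated series passes to the limit by
bounded convergence, applied both to the mean and to the exponential moment. *)
Lemma concentration : exists2 K : R, 0 < K & forall s, itv_partition 0 1 s ->
  P.-integrable setT (EFin \o V s) /\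
  forall lam, (\int[P]_w (expR (lam * V s w))%:E <=
    (expR (lam * fine (\int[P]_w (V s w)%:E) + lam ^+ 2 * (K * mesh s `^ kappa) / 8))%:E)%E.
Proof.
have [L L0 hL] := grid_variation_update H_gt0 H_lt1.
have [K K0 hK] := sum_sqr_sensitivity H_gt0 H_lt1 H_neq L.
have [C C0 hC] := grid_variation_bound H_gt0 H_lt1.
exists K => // s ps; have sg := itv_partition_grid ps.
have V0 : {ae P, forall w, VN s N w @[N --> \oo] --> V s w}.
  apply: filterS ae_sign => w /sign_vector_box hw; exact: cvg_truncated_variation.
have VC : {ae P, forall w N, `|VN s N w| <= C}.
  apply: filterS ae_sign => w /sign_vector_box hw N.
  rewrite ger0_norm; first exact: hC sg hw.
  by apply: sumr_ge0 => i _; exact: powR_ge0.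
have [iV cV] := bounded_convergence (measurable_truncated_variation s) (measurable_takagi_variation s) V0 VC.
split=> // lam.
have mE (X : T -> R) : measurable_fun setT X -> measurable_fun setT (fun w => expR (lam * X w)).
  by move=> mX; apply: measurableT_comp => //; exact: measurable_funM.
have [||_ cE] := @bounded_convergence _ _ _ P (fun N w => expR (lam * VN s N w))
   (fun w => expR (lam * V s w)) (expR (`|lam| * C)) (fun N => mE _ (measurable_truncated_variation s N))
   (mE _ (measurable_takagi_variation s)).
- apply: filterS V0 => w h.
  apply: cvg_expR.
  by apply: cvgM => //; exact: cvg_cst.
- apply: filterS VC => w h N; rewrite ger0_norm ?expR_ge0// ler_expR.
  by apply: le_trans (ler_norm _) _; rewrite normrM ler_wpM2l.
have fV : (\int[P]_w (V s w)%:E)%E \is a fin_num by exact: integrable_fin_num.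
have cm : fine (\int[P]_w (VN s N w)%:E)%E @[N --> \oo] --> fine (\int[P]_w (V s w)%:E)%E.
  by apply: fine_cvg; rewrite fineK.
pose B (m : R) := expR (lam * m + lam ^+ 2 * (K * mesh s `^ kappa) / 8).
have cB : ((B (fine (\int[P]_w (VN s N w)%:E)%E))%:E @[N --> \oo] -->
    (B (fine (\int[P]_w (V s w)%:E)%E))%:E)%E.
  apply: cvg_EFin; first exact: nearW.
  apply: cvg_expR.
  by apply: cvgD; [apply: cvgM => //; exact: cvg_cst|exact: cvg_cst].
apply: (lee_cvg_to cE cB); apply: nearW => N.
apply: (@expectation_exp_le _ _ _ P _ signs _ mutually_independent_signs (indices_below N)
  (grid_variation H (size s) (fun i => (0 :: s)`_i) N)
  (sensitivity H L (size s) (fun i => (0 :: s)`_i))).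
- by move=> j; exact: htheta.1.
- exact: uniq_indices_below.
- by move=> j jN s' hs'; apply: hL sg hs' _; rewrite -mem_indices_below.
- exact: hK.
- exact: measurable_truncated_variation.
- by move=> s'; apply: sumr_ge0 => i _; exact: powR_ge0.
- move=> s1 s2 h; apply: eq_bigr => i _.
  by rewrite !(signed_takagi_ext _ h).
Qed.

End process.

(** * Convergence of a concentrated sequence *)

Section concentrated_sequence.
Context (d : measure_display) (T : measurableType d) (R : realType).
Variables (P : probability T R) (V : nat -> T -> R) (m : nat -> R).
Hypothesis mV : forall n, measurable_fun setT (V n).
Hypothesis VP : forall t : R, 0 < t -> \forall n \near \oo,
  (P [set w | (t <= `|V n w - m n|)%R] <= (2 / n%:R ^+ 2)%:E)%E.

Lemma measurable_deviation_set (X Y : T -> R) (t : R) :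
  measurable_fun setT X -> measurable_fun setT Y ->
  measurable [set w | t <= `|X w - Y w|].
Proof.
move=> mX mY; rewrite [X in measurable X](_ : _ =
    (fun w => `|X w - Y w|) @^-1` `[t, +oo[); last first.
  by apply/seteqP; split=> w /=; rewrite in_itv/= andbT.
rewrite -[X in measurable X]setTI.
have : measurable_fun setT (fun w => `|X w - Y w|).
  by apply: measurableT_comp => //; exact: measurable_funB.
by apply.
Qed.

(** First Borel-Cantelli lemma; the partial sums of [2 / n ^+ 2] are controlled
by the telescoping majorant [4 - 4 / N]. *)
Lemma ae_eventually_close (t : R) : 0 < t ->
  {ae P, forall w, \forall n \near \oo, `|V n w - m n| < t}.
Proof.
move=> t0; have [n0 _ hn0] := VP t0.
(* Discarding finitely many events leaves the superior limit unchanged. *)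
pose F n := if (maxn n0 1 <= n)%N then [set w | t <= `|V n w - m n|] else set0.
have mF n : measurable (F n).
  rewrite /F; case: ifP => _ //.
  by apply: measurable_deviation_set => //; exact: measurable_cst.
have sumF N : (\sum_(0 <= n < N.+1) P (F n) <= (4 - 4 / N.+1%:R)%:E)%E.
  elim: N => [|N IH].
    rewrite big_nat1 /F leqNgt (leq_trans _ (leq_maxr _ _))//= measure0.
    by rewrite lee_fin divr1 subrr.
  rewrite big_nat_recr//=; apply: (@le_trans _ _
    ((4 - 4 / N.+1%:R)%:E + (2 / N.+1%:R ^+ 2)%:E)%E).
    apply: leeD => //; rewrite /F; case: ifP => [|_]; last first.
      by rewrite measure0 lee_fin divr_ge0 ?sqr_ge0.
    by rewrite geq_max => /andP[h _]; exact: hn0.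
  rewrite -EFinD lee_fin -[N.+2%:R]natr1.
  have : (1 : R) <= N.+1%:R by rewrite ler1n.
  set x : R := N.+1%:R => x1.
  rewrite -subr_ge0 (_ : _ - _ = 2 * (x - 1) / (x ^+ 2 * (x + 1))).
    by rewrite divr_ge0 ?mulr_ge0 ?sqr_ge0//; lra.
  by field; rewrite !gt_eqF//; lra.
have F0 : P (lim_sup_set F) = 0%E.
  apply: lim_sup_set_cvg0 => //.
  apply: (@le_lt_trans _ _ 4%:E); last exact: ltry.
  apply: lime_le; first exact: is_cvg_nneseries.
  apply: nearW => -[|N]; first by rewrite big_geq.
  apply: le_trans (sumF N) _; rewrite lee_fin.
  by rewrite lerBlDr lerDl.
exists (lim_sup_set F); split=> //.
  apply: bigcap_measurableType => k _; exact: bigcup_measurable.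
move=> w /= hw N _ /=; apply: contrapT => hN; apply: hw.
exists (maxn (maxn n0 1) N) => // n /= hn.
rewrite ltNge; apply/negP => tn; apply: hN; exists n => /=.
  exact: leq_trans (leq_maxr _ _) hn.
by rewrite /F (leq_trans (leq_maxl _ _) hn).
Qed.

Lemma ae_cvg_deviation0 : {ae P, forall w, V n w - m n @[n --> \oo] --> 0}.
Proof.
have : {ae P, forall w k, \forall n \near \oo, `|V n w - m n| < k.+1%:R^-1}.
  by apply/ae_foralln => k; apply: ae_eventually_close; rewrite invr_gt0.
apply: filterS => w h; apply/cvgr0Pnorm_lt => e e0.
have /cvgr_lt /(_ _ e0) [k _ hk] := @cvg_harmonic R.
by apply: filterS (h k) => n /lt_trans; apply; exact: (hk k (leqnn k)).
Qed.

Lemma deviation_prob_eventually_le (t e : R) : 0 < t -> 0 < e ->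
  \forall n \near \oo, (P [set w | (t <= `|V n w - m n|)%R] <= e%:E)%E.
Proof.
move=> t0 e0; have e20 : 0 < e / 2 by rewrite divr_gt0.
have /cvgr_lt /(_ _ e20) [k _ hk] := @cvg_harmonic R.
have h := VP t0; near=> n.
apply: (@le_trans _ _ (2 / n%:R ^+ 2)%:E); first by near: n.
have kn : (k < n)%N by near: n; exists k.+1.
have := hk n.-1; rewrite /= -ltnS prednK ?(leq_trans _ kn)// => /(_ isT).
have : (1 : R) <= n%:R by rewrite ler1n (leq_trans _ kn).
set x : R := n%:R => x1 hx; rewrite lee_fin.
have x0 : 0 < x by lra.
rewrite mulrC -ler_pdivlMr//; apply: le_trans (ltW hx).
by rewrite lef_pV2 ?posrE ?exprn_gt0// expr2 ler_peMl// ltW.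
Unshelve. all: by end_near. Qed.

Lemma cvg_converges_as (l : R) : m @ \oo --> l ->
  {ae P, forall w, V n w @[n --> \oo] --> l}.
Proof.
move=> ml; apply: filterS ae_cvg_deviation0 => w h.
rewrite (_ : (fun n => V n w) = fun n => (V n w - m n) + m n); last first.
  by apply/funext => n; rewrite subrK.
by rewrite -[X in _ --> X]add0r; exact: cvgD.
Qed.

Lemma ae_exists (Q : T -> Prop) : {ae P, forall w, Q w} -> exists w, Q w.
Proof.
move=> [N [mN N0 QN]]; apply: contrapT => hQ.
have : (P setT <= P N)%E.
  by apply: le_measure; rewrite ?inE// => w _; apply: QN => Qw; apply: hQ; exists w.
by rewrite N0 probability_setT lee_fin ler10.
Qed.

Lemma converges_as_mean : converges_as P V -> exists l : R, m @ \oo --> l.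
Proof.
move=> hV; have [w [h1 h2]] : exists w, cvgn (fun n => V n w) /\
    V n w - m n @[n --> \oo] --> 0.
  by apply: ae_exists; apply: filterS2 hV ae_cvg_deviation0.
exists (limn (fun n => V n w) - 0).
rewrite (_ : m = fun n => V n w - (V n w - m n)); first exact: cvgB.
by apply/funext => n; rewrite opprB addrC subrK.
Qed.

(** If [V n] is close to a random variable [Y] and to the constant [m n] with
probability above 3/4 for all large [n], then for any two large indices these
events have a common point, so [m] is a Cauchy sequence. *)
Lemma converges_in_probability_mean :
  converges_in_probability P V -> exists l : R, m @ \oo --> l.
Proof.
move=> [Y hY]; apply/cvg_ex/cauchy_cvgP/cauchy_exP => e e0.
pose t := e / 4; have t0 : 0 < t by rewrite divr_gt0.
pose B n := [set w | t <= `|V n w - Y w|] `|` [set w | t <= `|V n w - m n|].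
have mB1 n : measurable [set w | t <= `|V n w - Y w|] by apply: measurable_deviation_set.
have mB2 n : measurable [set w | t <= `|V n w - m n|].
  by apply: measurable_deviation_set => //; exact: measurable_cst.
have hB : \forall n \near \oo, (P (B n) < (2^-1)%:E)%E.
  have q0 : (0 : R) < 8^-1 by [].
  have h1 := deviation_prob_eventually_le t0 q0.
  have h2 : \forall n \near \oo, (P [set w | (t <= `|V n w - Y w|)%R] < (8^-1)%:E)%E.
    have /fine_cvgP[_ /cvgr0Pnorm_lt /(_ _ q0)] := hY t t0.
    apply: filterS => n /=; rewrite -lte_fin; apply: le_lt_trans.
    by rewrite -[leLHS]fineK ?fin_num_measure// lee_fin ler_norm.
  apply: filterS2 h1 h2 => n h1 h2.
  apply: le_lt_trans (measureU2 P (mB1 n) (mB2 n)) _.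
  apply: (@le_lt_trans _ _ ((8^-1)%:E + (8^-1)%:E)%E).
    by apply: leeD => //; exact: ltW.
  by rewrite -EFinD lte_fin; lra.
have [N _ hN] := hB; exists (m N); exists N => // n /= Nn.
have [w hw] : exists w, ~ (B N `|` B n) w.
  apply: contrapT => h.
  have : (P setT <= P (B N `|` B n))%E.
    apply: le_measure; rewrite ?inE//.
      by apply: measurableU; apply: measurableU.
    by move=> w _; apply: contrapT => hw; apply: h; exists w.
  rewrite probability_setT leNgt => /negP; apply.
  apply: le_lt_trans (measureU2 P _ _) _; [exact: measurableU|exact: measurableU|].
  apply: (@lt_le_trans _ _ ((2^-1)%:E + (2^-1)%:E)%E).
    by apply: lteD; apply: hN => /=.
  by rewrite -EFinD lee_fin; lra.
rewrite /ball/=; move/not_orP: hw => [/not_orP[/= + +] /not_orP[/= + +]].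
do 4! (move=> /negP; rewrite -ltNge ltr_norml /t => /andP[? ?]).
by rewrite ltr_norml; apply/andP; split; lra.
Qed.

Lemma cvg_converges_in_probability (l : R) : m @ \oo --> l ->
  converges_in_probability P V.
Proof.
move=> ml; exists (cst l) => e e0; have e20 : 0 < e / 2 by rewrite divr_gt0.
apply/fine_cvgP; split.
  apply: nearW => n; apply: fin_num_measure.
  by apply: measurable_deviation_set => //; exact: measurable_cst.
apply/cvgr0Pnorm_le => r r0.
have h1 := deviation_prob_eventually_le e20 r0.
have /cvgr_distC_lt /(_ _ e20) h2 := ml.
apply: filterS2 h1 h2 => n h1 h2.
have mA : measurable [set w | e <= `|V n w - cst l w|].
  by apply: measurable_deviation_set => //; exact: measurable_cst.
rewrite /= ger0_norm ?fine_ge0// -lee_fin fineK ?fin_num_measure//.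
apply: le_trans h1; apply: le_measure; rewrite ?inE//.
  by apply: measurable_deviation_set => //; exact: measurable_cst.
move=> w /= h; have : V n w - l = (V n w - m n) + (m n - l) by ring.
move=> E; rewrite E in h.
have := ler_normD (V n w - m n) (m n - l); lra.
Qed.

End concentrated_sequence.

(** * Equivalence of the three modes of convergence *)

Theorem corollary2p11 (R : realType) (d : measure_display)
    (Omega : measurableType d) (P : probability Omega R)
    (theta : forall n : nat, 'I_(2 ^ n) -> {RV P >-> R})
    (htheta : independent_rademacher theta)
    (H : R) (H_gt0 : 0 < H) (H_lt1 : H < 1) (H_neq : H != 2^-1)
    (part : nat -> seq R)
    (part_partition : forall n : nat, (0 < n)%N -> itv_partition 0 1 (part n))
    (part_mesh : let kappa := Num.min 1 (2 - 2 * H) in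
      (fun n : nat => mesh (part n)) =o_\oo
      (fun n : nat => (ln n%:R : R) `^ (- kappa^-1))) :
  let p := H^-1 in
  let V (n : nat) (w : Omega) : R :=
    pvariation p (part n) (fun t => takagi_landsberg H theta t w) in
  [/\ converges_as P V <-> converges_in_probability P V,
      converges_in_probability P V <->
        (exists l : R, ('E_P[V n])%E @[n --> \oo] --> l%:E) &
      forall l : R, ('E_P[V n])%E @[n --> \oo] --> l%:E ->
        {ae P, forall w, V n w @[n --> \oo] --> l}].
Proof.
move=> p V; set kappa := Num.min 1 (2 - 2 * H) in part_mesh.
have k0 : 0 < kappa by rewrite lt_min ltr01 subr_gt0 -[ltRHS]mulr1 ltr_pM2l.
have [K K0 hK] := concentration htheta H_gt0 H_lt1 H_neq.
have mV n : measurable_fun setT (V n) by exact: measurable_takagi_variation.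
pose m n := fine ('E_P[V n])%E.
have EV n : (0 < n)%N -> ('E_P[V n])%E = (m n)%:E.
  move=> n0; rewrite /m fineK// unlock; apply: integrable_fin_num => //.
  by have [] := hK _ (part_partition n n0).
have VP t : 0 < t -> \forall n \near \oo,
    (P [set w | (t <= `|V n w - m n|)%R] <= (2 / n%:R ^+ 2)%:E)%E.
  move=> t0; pose delta := t ^+ 2 / K.
  have delta0 : 0 < delta by rewrite divr_gt0 ?exprn_gt0.
  have /eqoP /(_ (delta `^ kappa^-1)) := part_mesh.
  rewrite powR_gt0// => /(_ isT) hmesh.
  have n2 : \forall n \near \oo, (1 < n)%N by exists 2%N.
  apply: filterS2 hmesh n2 => n hmesh n1.
  have n0 : (0 < n)%N by exact: ltnW.
  have lnn : 0 < ln (n%:R : R) by rewrite ln_gt0// ltr1n.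
  have [_ hm] := hK _ (part_partition n n0).
  (* With mesh ^ kappa at most t ^ 2 / (K ln n), the tail at level t becomes
     2 exp (- 2 ln n). *)
  have mesh_le : mesh (part n) `^ kappa <= delta / ln n%:R.
    move: hmesh; rewrite !ger0_norm ?powR_ge0 ?mesh_ge0// => hmesh.
    apply: (@le_trans _ _
      ((delta `^ kappa^-1 * (ln n%:R : R) `^ (- kappa^-1)) `^ kappa)).
      by apply: ge0_ler_powR; rewrite ?nnegrE ?mesh_ge0 ?mulr_ge0 ?powR_ge0 ?(ltW k0).
    rewrite powRM ?powR_ge0// -!powRrM mulNr mulVf ?gt_eqF//.
    by rewrite powRr1 ?(ltW delta0)// powR_inv1// ltW.
  have K'0 : 0 < t ^+ 2 / ln n%:R by rewrite divr_gt0 ?exprn_gt0.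
  have := @chernoff_tail _ _ _ P (V n) (m n) (t ^+ 2 / ln n%:R) t (mV n) K'0 t0.
  have -> : 2 * t ^+ 2 / (t ^+ 2 / ln n%:R) = ln n%:R + ln n%:R.
    by field; rewrite !gt_eqF.
  rewrite opprD expRD expRN lnK ?posrE ?ltr0n//.
  have -> : (n%:R^-1 * n%:R^-1 = (n%:R ^+ 2)^-1 :> R) by rewrite expr2 invfM.
  apply => lam; apply: le_trans (hm lam) _.
  rewrite lee_fin ler_expR /m unlock lerD2l ler_pM2r ?invr_gt0//.
  rewrite ler_wpM2l ?sqr_ge0// (le_trans (ler_wpM2l (ltW K0) mesh_le))//.
  by rewrite /delta le_eqVlt; apply/orP; left; apply/eqP; field; rewrite !gt_eqF.
have near0 : \forall n \near \oo, (0 < n)%N by exists 1%N.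
have EmP l : ('E_P[V n])%E @[n --> \oo] --> l%:E <-> m @ \oo --> l.
  split=> [/fine_cvg //|ml].
  apply: cvg_EFin => //.
  by apply: filterS near0 => n n0; rewrite EV.
split.
- split=> [/(converges_as_mean mV VP)[l]|/(converges_in_probability_mean mV VP)[l]] ml.
    exact: (cvg_converges_in_probability mV VP ml).
  by apply: filterS (cvg_converges_as mV VP ml) => w h; apply/cvg_ex; exists l.
- split=> [/(converges_in_probability_mean mV VP)[l ml]|[l /EmP ml]].
    by exists l; apply/EmP.
  exact: (cvg_converges_in_probability mV VP ml).
- by move=> l /EmP ml; exact: (cvg_converges_as mV VP ml).
Qed.
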